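(* Work in $\mathsf{ZF}$. Let $\kappa$ be a cardinal and $\mathbb{P}$ a notion of forcing. (a) If $\mathbb{P}$ is $\kappa$-descending distributive then it adds no fresh functions $\kappa\to V$. (b) Suppose that for all $V$-generic filters $G\subseteq\mathbb{P}$ and all open dense sets $D\subseteq\mathbb{P}$ with $D\in V$, we have $G\setminus D\in V$. Then $\mathbb{P}$ is $\kappa$-descending distributive if and only if it adds no fresh functions $\kappa\to V$.
   Context: The base theory is $\mathsf{ZF}$ (no axiom of choice); $V$ is the ground model. ''Cardinal'' means an initial ordinal. A notion of forcing is a partial order with a maximum element, assumed throughout to be separative (if $p'\nleq p$ then there is $q\leq p'$ incompatible with $p$); $q\leq p$ means $q$ is stronger; open sets are closed under strengthening. $\mathbb{P}$ is $\kappa$-descending distributive if for every decreasing sequence $\langle D_\alpha\mid\alpha<\kappa\rangle$ of open dense subsets of $\mathbb{P}$ (i.e. $D_\alpha\supseteq D_\beta$ for $\alpha<\beta<\kappa$), $\bigcap_{\alpha<\kappa}D_\alpha$ is open dense. A function $f\colon\kappa\to V$ is fresh (over $V$) if $f\notin V$ but $f\upharpoonright\alpha\in V$ for all $\alpha<\kappa$. $\mathbb{P}$ adds no fresh functions $\kappa\to V$ if for no $V$-generic $G\subseteq\mathbb{P}$ does $V[G]$ contain such a function. *)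

(* Defs.v *)
(* Forcing over a transitive model V of ZF.  The classes V and V[G] live in the
   universe [SET] of iterative sets; V is a set-sized or class-sized transitive
   model presented up to isomorphism, that is, as a type with a well-founded
   membership relation satisfying ZF (ZF includes extensionality, so by
   Mostowski the collapse [emb] identifies V with a transitive subclass of
   [SET]).  No choice principle is assumed to hold in V. *)
From Stdlib Require Import Relations Wellfounded.
From Stdlib Require Import Classical ClassicalEpsilon FunctionalExtensionality.

Set Implicit Arguments.
Unset Strict Implicit.
Unset Printing Implicit Defensive.

(* -------------------- Set-theoretic notions over a relation --------------- *)

(* These are used both for the membership relation of V and for that of [SET];
   on [SET] equality of sets is coextensionality, whence [same]. *)
Section Notions.
Context {U : Type} (E : U -> U -> Prop).

Definition same (x y : U) := forall z, E z x <-> E z y.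

Definition subset (x y : U) := forall z, E z x -> E z y.

Definition is_upair (c a b : U) := forall z, E z c <-> same z a \/ same z b.

(* Kuratowski pair: c = {{a}, {a, b}}. *)
Definition is_opair (c a b : U) :=
  exists u v, is_upair u a a /\ is_upair v a b /\ is_upair c u v.

(* (a, b) is an element of the relation r *)
Definition related (r a b : U) := exists z, is_opair z a b /\ E z r.

Definition function_on (f d : U) :=
  (forall z, E z f -> exists a b, E a d /\ is_opair z a b) /\
  (forall a, E a d -> exists b, related f a b) /\
  (forall a b b', related f a b -> related f a b' -> same b b').

(* g is the restriction of f to d *)
Definition is_restriction (g f d : U) :=
  forall z, E z g <-> E z f /\ exists a b, E a d /\ is_opair z a b.

Definition bijection (f a b : U) :=
  function_on f a /\
  (forall x y, related f x y -> E y b) /\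
  (forall y, E y b -> exists x, related f x y) /\
  (forall x x' y, related f x y -> related f x' y -> same x x').

(* By foundation, a transitive set of transitive sets is an ordinal. *)
Definition transitive_set (x : U) := forall y, E y x -> subset y x.

Definition ordinal (x : U) :=
  transitive_set x /\ forall y, E y x -> transitive_set y.

(* Initial ordinals, the finite ones included. *)
Definition cardinal (k : U) :=
  ordinal k /\ forall a, E a k -> ~ exists f, bijection f a k.

End Notions.

(* -------------------- First-order formulas and ZF ------------------------- *)

(* Formulas of the language {=, in} with de Bruijn indices. *)
Inductive formula : Type :=
| fMem (i j : nat)
| fEq (i j : nat)
| fBot
| fImp (A B : formula)
| fAll (A : formula).

Definition scons {U : Type} (x : U) (e : nat -> U) (n : nat) : U :=
  match n with O => x | S m => e m end.

Fixpoint sat {U : Type} (E : U -> U -> Prop) (e : nat -> U) (A : formula) : Prop :=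
  match A with
  | fMem i j => E (e i) (e j)
  | fEq i j => e i = e j
  | fBot => False
  | fImp B C => sat E e B -> sat E e C
  | fAll B => forall x, sat E (scons x e) B
  end.

(* In the two schemes the environment e supplies the parameters. *)
Record ZF {U : Type} (E : U -> U -> Prop) : Prop := {
  ZF_extensionality : forall x y, (forall z, E z x <-> E z y) -> x = y;
  ZF_foundation : forall x, (exists y, E y x) ->
    exists y, E y x /\ forall z, E z y -> ~ E z x;
  ZF_pairing : forall a b, exists c, forall z, E z c <-> z = a \/ z = b;
  ZF_union : forall a, exists u, forall z, E z u <-> exists y, E y a /\ E z y;
  ZF_power : forall a, exists p, forall z, E z p <-> subset E z a;
  ZF_infinity : exists w,
    (exists o, E o w /\ forall z, ~ E z o) /\
    (forall x, E x w -> exists s, E s w /\ forall z, E z s <-> E z x \/ z = x);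
  ZF_separation : forall (A : formula) (e : nat -> U) (a : U),
    exists b, forall x, E x b <-> E x a /\ sat E (scons x e) A;
  ZF_replacement : forall (A : formula) (e : nat -> U) (a : U),
    (forall x y y', E x a ->
       sat E (scons y (scons x e)) A -> sat E (scons y' (scons x e)) A -> y = y') ->
    exists b, forall y,
      E y b <-> exists x, E x a /\ sat E (scons y (scons x e)) A
}.

Record transitive_model : Type := {
  carrier :> Type;
  mem : carrier -> carrier -> Prop;
  mem_wf : well_founded mem;
  mem_ZF : ZF mem
}.
Arguments mem {V} : rename.
Arguments mem_wf V : rename, clear implicits.

(* -------------------- The ambient universe of sets ------------------------ *)

Inductive SET : Type := sup (A : Type) (F : A -> SET).

Fixpoint set_eq (x y : SET) : Prop :=
  match x, y with
  | sup F, sup H =>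
      (forall a, exists b, set_eq (F a) (H b)) /\
      (forall b, exists a, set_eq (F a) (H b))
  end.

Definition set_mem (x y : SET) : Prop :=
  match y with sup F => exists a, set_eq x (F a) end.

(* The Mostowski collapse of V. *)
Definition emb (V : transitive_model) : V -> SET :=
  Fix (mem_wf V) (fun _ => SET)
    (fun x rec => sup (fun y : {y : V | mem y x} => rec (proj1_sig y) (proj2_sig y))).

Definition in_V (V : transitive_model) (x : SET) : Prop :=
  exists m : V, set_eq x (emb m).

(* -------------------- Notions of forcing in V ----------------------------- *)

Record forcing (V : transitive_model) : Type := {
  cond : V;
  order : V;
  top : V;
  le (q p : V) : Prop := related mem order q p;
  le_refl : forall p, mem p cond -> le p p;
  le_trans : forall p q r, mem p cond -> mem q cond -> mem r cond ->
    le r q -> le q p -> le r p;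
  le_antisym : forall p q, mem p cond -> mem q cond -> le p q -> le q p -> p = q;
  top_cond : mem top cond;
  le_top : forall p, mem p cond -> le p top;
  separative : forall p p', mem p cond -> mem p' cond -> ~ le p' p ->
    exists q, mem q cond /\ le q p' /\
      ~ exists r, mem r cond /\ le r q /\ le r p
}.
Arguments cond {V} P : rename.
Arguments order {V} P : rename.
Arguments top {V} P : rename.
Arguments le {V} P q p : rename.

Section Forcing.
Variables (V : transitive_model) (P : forcing V).

Definition dense (D : V -> Prop) :=
  (forall p, D p -> mem p (cond P)) /\
  forall p, mem p (cond P) -> exists q, D q /\ le P q p.

Definition open (D : V -> Prop) :=
  (forall p, D p -> mem p (cond P)) /\
  forall p q, D p -> mem q (cond P) -> le P q p -> D q.

Definition open_dense (D : V -> Prop) := open D /\ dense D.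

Definition elements (D : V) : V -> Prop := fun p => mem p D.

(* s is, in V, a decreasing sequence of length k of open dense sets *)
Definition decreasing_open_dense_sequence (k s : V) :=
  function_on mem s k /\
  (forall a D, mem a k -> related mem s a D -> open_dense (elements D)) /\
  (forall a b D D', mem b k -> mem a b ->
     related mem s a D -> related mem s b D' -> subset mem D' D).

(* For k = 0 the intersection is the whole of P. *)
Definition descending_distributive (k : V) :=
  forall s, decreasing_open_dense_sequence k s ->
    open_dense (fun p => mem p (cond P) /\
      forall a D, mem a k -> related mem s a D -> mem p D).

Definition generic (G : V -> Prop) :=
  (forall p, G p -> mem p (cond P)) /\
  G (top P) /\
  (forall p q, G p -> mem q (cond P) -> le P p q -> G q) /\
  (forall p q, G p -> G q -> exists r, G r /\ le P r p /\ le P r q) /\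
  (forall D : V, dense (elements D) -> exists p, G p /\ mem p D).

(* Generic filters are not elements of V; that each condition belongs to one is
   the convention under which quantifying over all generic filters is
   meaningful.  It holds whenever V is countable, see
   [countable_has_generic_filters]. *)
Definition has_generic_filters :=
  forall p, mem p (cond P) -> exists G, generic G /\ G p.

End Forcing.

(* -------------------- Generic extensions ---------------------------------- *)

Section Extension.
Variable V : transitive_model.

Definition subname (s t : V) := exists p, related mem t s p.

Lemma subname_clos s t : subname s t -> clos_trans V mem s t.
Proof.
intros [p [z [[u [v [Hu [_ Hz]]]] Hzt]]].
assert (Hs : mem s u) by (apply Hu; left; intro; tauto).
assert (Huz : mem u z) by (apply Hz; left; intro; tauto).
apply t_trans with z; [apply t_trans with u|]; now apply t_step.
Qed.

Lemma subname_wf : well_founded subname.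
Proof.
apply wf_incl with (clos_trans V mem).
- intros s t; apply subname_clos.
- apply wf_clos_trans, mem_wf.
Qed.

(* val G t = { val G s | (s, p) in t for some p in G }.  Every element of V
   counts as a name; elements of t that are not pairs are ignored. *)
Definition val (G : V -> Prop) : V -> SET :=
  Fix subname_wf (fun _ => SET)
    (fun t rec =>
       sup (fun s : {s : V | exists p, G p /\ related mem t s p} =>
         rec (proj1_sig s)
           (match proj2_sig s with
            | ex_intro _ p H => ex_intro _ p (proj2 H)
            end))).

Definition in_extension (G : V -> Prop) (x : SET) : Prop :=
  exists t : V, set_eq x (val G t).

(* f is a fresh function from k to V *)
Definition fresh (k : V) (f : SET) :=
  function_on set_mem f (emb k) /\
  (forall a b, related set_mem f a b -> in_V V b) /\
  ~ in_V V f /\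
  (forall a : V, mem a k ->
     exists g, is_restriction set_mem g f (emb a) /\ in_V V g).

Definition adds_no_fresh_functions (P : forcing V) (k : V) :=
  forall G, generic P G -> ~ exists f, in_extension G f /\ fresh k f.

End Extension.

(* -------------------- Basic facts ----------------------------------------- *)

Lemma set_eq_refl x : set_eq x x.
Proof. induction x as [A F IH]; simpl; split; intro a; exists a; apply IH. Qed.

Lemma set_eq_sym x y : set_eq x y -> set_eq y x.
Proof.
revert y; induction x as [A F IH]; intros [B H] [h1 h2]; simpl; split.
- intro b; destruct (h2 b) as [a Ha]; exists a; now apply IH.
- intro a; destruct (h1 a) as [b Hb]; exists b; now apply IH.
Qed.

Lemma set_eq_trans x y z : set_eq x y -> set_eq y z -> set_eq x z.
Proof.
revert y z; induction x as [A F IH]; intros [B H] [C K] [h1 h2] [k1 k2].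
simpl; split.
- intro a; destruct (h1 a) as [b Hb]; destruct (k1 b) as [c Hc].
  exists c; now apply IH with (H b).
- intro c; destruct (k2 c) as [b Hb]; destruct (h2 b) as [a Ha].
  exists a; now apply IH with (H b).
Qed.

Lemma set_mem_eq_l x y z : set_eq x y -> set_mem x z -> set_mem y z.
Proof.
destruct z as [A F]; intros Hxy [a Ha]; exists a.
apply set_eq_trans with x; [now apply set_eq_sym | exact Ha].
Qed.

Lemma set_eq_same x y : set_eq x y <-> same set_mem x y.
Proof.
split.
- destruct x as [A F], y as [B H]; intros [h1 h2] z; split.
  + intros [a Ha]; destruct (h1 a) as [b Hb]; exists b.
    now apply set_eq_trans with (F a).
  + intros [b Hb]; destruct (h2 b) as [a Ha]; exists a.
    apply set_eq_trans with (H b); [exact Hb | now apply set_eq_sym].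
- destruct x as [A F], y as [B H]; intro Hs; simpl; split.
  + intro a; apply (Hs (F a)); exists a; apply set_eq_refl.
  + intro b; destruct (proj2 (Hs (H b))) as [a Ha].
    * exists b; apply set_eq_refl.
    * exists a; now apply set_eq_sym.
Qed.

Lemma set_mem_emb (V : transitive_model) (m : V) x :
  set_mem x (emb m) <-> exists y, mem y m /\ set_eq x (emb y).
Proof.
unfold emb at 1; rewrite Fix_eq.
- simpl; split.
  + intros [[y Hy] H]; now exists y.
  + intros [y [Hy H]]; now exists (exist _ y Hy).
- intros t f g Hfg; f_equal; apply functional_extensionality; intros [y Hy].
  apply Hfg.
Qed.

Lemma set_mem_val (V : transitive_model) (G : V -> Prop) (t : V) x :
  set_mem x (val G t) <->
  exists s p, G p /\ related mem t s p /\ set_eq x (val G s).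
Proof.
unfold val at 1; rewrite Fix_eq.
- simpl; split.
  + intros [[s [p [Hp Hs]]] H]; now exists s, p.
  + intros [s [p [Hp [Hs H]]]]; now exists (exist _ s (ex_intro _ p (conj Hp Hs))).
- intros u f g Hfg; f_equal; apply functional_extensionality; intros s.
  apply Hfg.
Qed.

Lemma countable_has_generic_filters (V : transitive_model) (P : forcing V) :
  (exists c : nat -> V, forall x, exists n, c n = x) -> has_generic_filters P.
Proof.
intros [c Hc] p0 Hp0.
pose (step := fun n p q => mem p (cond P) ->
  mem q (cond P) /\ le P q p /\ (dense P (elements (c n)) -> mem q (c n))).
assert (Hstep : forall n p, exists q, step n p q).
{ intros n p; unfold step.
  destruct (classic (mem p (cond P))) as [Hp|Hp]; [|now exists p].
  destruct (classic (dense P (elements (c n)))) as [HD|HD].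
  - destruct (proj2 HD p Hp) as [q [Hq Hle]]; exists q; intros _.
    split; [now apply HD|now split].
  - exists p; intros _; split; [exact Hp|split; [now apply le_refl|tauto]]. }
pose (s := fix s n := match n with
  | O => p0
  | S m => proj1_sig (constructive_indefinite_description _ (Hstep m (s m))) end).
assert (Hs : forall n, step n (s n) (s (S n))).
{ intro n; simpl.
  now destruct (constructive_indefinite_description _ (Hstep n (s n))). }
assert (HP : forall n, mem (s n) (cond P)).
{ induction n as [|n IH]; [exact Hp0|now apply (Hs n)]. }
assert (Hd : forall k n, le P (s (k + n)) (s n)).
{ induction k as [|k IH]; intro n; [apply le_refl, HP|].
  apply le_trans with (s (k + n)); try apply HP; [now apply (Hs (k + n)), HP|apply IH]. }
exists (fun p => mem p (cond P) /\ exists n, le P (s n) p); split;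
  [split; [|split; [|split; [|split]]]|].
- now intros p [Hp _].
- split; [apply top_cond|exists 0; apply le_top, HP].
- intros p q [Hp [n Hn]] Hq Hpq; split; [exact Hq|exists n].
  apply le_trans with p; auto.
- intros p q [Hp [n Hn]] [Hq [m Hm]]; exists (s (n + m)).
  split; [split; [apply HP|exists (n + m); apply le_refl, HP]|split].
  + apply le_trans with (s n); try apply HP; auto.
    rewrite PeanoNat.Nat.add_comm; apply Hd.
  + apply le_trans with (s m); try apply HP; auto.
- intros D HD; destruct (Hc D) as [n Hn]; subst D; exists (s (S n)).
  split; [split; [apply HP|exists (S n); apply le_refl, HP]|].
  now apply (Hs n).
- split; [exact Hp0|exists 0; now apply le_refl].
Qed.

(* Main.v *)
Require Import Defs.
From Stdlib Require Import PeanoNat Classical FunctionalExtensionality.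

(** Part (a).  Let [f] be fresh with name [t] in [V[G]], and let [D_a] be the set
    of conditions deciding the values of [f] at all [b <= a].  Each restriction
    of [f] to an ordinal below [k] lies in [V], so [G] meets every [D_a]; by
    genericity some [p0] in [G] has every [D_a] dense below it.  Adding to [D_a]
    the conditions incompatible with [p0] gives a decreasing sequence of open
    dense sets.  Its intersection is dense, so [G] meets it in a condition that
    decides all of [f] at once ([descending_distributive_no_fresh]), and [f] can
    be read off from that condition inside [V].

    Part (b).  Suppose that the intersection of a decreasing sequence [D_a] of
    open dense sets has no element below [p0], and let [G] contain [p0].  Then [G]
    misses the intersection, so it is the union of the remainders [G \ D_a].  The
    function sending [a] to [G \ D_a] takes values in [V] by hypothesis.  Its
    restriction to [a] can be computed from [G \ D_a] alone, because the sequence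
    decreases: [G \ D_b = (G \ D_a) \ D_b] for [b < a].  The whole function
    cannot be in [V], as otherwise [G] would be; a separative forcing with a
    generic filter in [V] has a condition all of whose strengthenings are in that
    filter, and such a condition lies in every open dense set.  So the function
    is fresh ([no_fresh_descending_distributive]).

    Both arguments need the forcing theorem only for the statements that a name
    is equal to, or contains, a given element of [V].  For these the forcing
    relation is positive in its own earlier values, so it can be defined in [V]
    by the existence of a set of triples that justify each other
    ([forces_eq]); the truth lemma [truth_eq] is then an induction on names.
    Check names are defined in the same way ([check]).  As the axiom schemes of
    ZF speak of formulas, every class to which they are applied must be shown to
    be given by a formula with parameters; [definable] is closed under the
    logical operations, and a tactic follows the syntax of the predicate. *)

Set Implicit Arguments.
Unset Strict Implicit.

(** * Definability with parameters *)

Section Definability.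
Context {U : Type} (E : U -> U -> Prop).

Fixpoint rename (r : nat -> nat) (A : formula) : formula :=
  match A with
  | fMem i j => fMem (r i) (r j)
  | fEq i j => fEq (r i) (r j)
  | fBot => fBot
  | fImp B C => fImp (rename r B) (rename r C)
  | fAll B => fAll (rename (fun n => match n with O => O | S m => S (r m) end) B)
  end.

Lemma sat_rename A : forall r e,
  sat E e (rename r A) <-> sat E (fun n => e (r n)) A.
Proof.
induction A as [i j|i j| |B IHB C IHC|B IHB]; intros r e; simpl; try tauto.
- rewrite IHB, IHC; tauto.
- assert (H : forall x, sat E (scons x e)
      (rename (fun n => match n with O => O | S m => S (r m) end) B) <->
      sat E (scons x (fun n => e (r n))) B); [|split; intros K x; apply H, K].
  intro x; rewrite IHB.
  replace (scons x (fun n => e (r n))) with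
    (fun n => scons x e match n with O => O | S m => S (r m) end); [tauto|].
  apply functional_extensionality; now intros [|n].
Qed.

Definition look (e : nat -> U) (a : nat + U) : U :=
  match a with inl i => e i | inr c => c end.

(** The map [s] says how each free variable of [A] is read: as an entry of the
    environment or as a parameter.  Keeping the parameters out of the environment
    lets predicates with different parameters be combined. *)
Definition definable (phi : (nat -> U) -> Prop) :=
  exists (A : formula) (s : nat -> nat + U),
    forall e, sat E (fun n => look e (s n)) A <-> phi e.

Definition definable1 (Q : U -> Prop) := definable (fun e => Q (e 0)).
Definition definable2 (Q : U -> U -> Prop) := definable (fun e => Q (e 0) (e 1)).
Definition definable3 (Q : U -> U -> U -> Prop) :=
  definable (fun e => Q (e 0) (e 1) (e 2)).

Definition is_term (t : (nat -> U) -> U) := exists a, forall e, t e = look e a.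

Lemma is_term_var i : is_term (fun e => e i).
Proof. now exists (inl i). Qed.

Lemma is_term_const c : is_term (fun _ => c).
Proof. now exists (inr c). Qed.

Lemma is_term_shift t : is_term t -> is_term (fun e => t (fun n => e (S n))).
Proof.
intros [[i|c] H]; [exists (inl (S i))|exists (inr c)]; intro e; now rewrite H.
Qed.

Lemma definable_ext phi psi :
  definable phi -> (forall e, phi e <-> psi e) -> definable psi.
Proof.
intros [A [s H]] K; exists A, s; intro e; now rewrite H.
Qed.

Lemma definable_subst phi (a : nat -> nat + U) :
  definable phi -> definable (fun e => phi (fun i => look e (a i))).
Proof.
intros [A [s H]].
exists A, (fun n => match s n with inl i => a i | inr c => inr c end).
intro e; rewrite <- H.
replace (fun n => look e match s n with inl i => a i | inr c => inr c end)
  with (fun n => look (fun i => look e (a i)) (s n)); [tauto|].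
apply functional_extensionality; intro n; now destruct (s n).
Qed.

Lemma definable3_app Q t u v :
  definable3 Q -> is_term t -> is_term u -> is_term v ->
  definable (fun e => Q (t e) (u e) (v e)).
Proof.
intros HQ [a Ha] [b Hb] [c Hc].
apply (definable_ext (definable_subst
  (fun i => match i with 0 => a | 1 => b | _ => c end) HQ)).
intro e; cbv beta iota; now rewrite <- Ha, <- Hb, <- Hc.
Qed.

Lemma definable2_app Q t u :
  definable2 Q -> is_term t -> is_term u -> definable (fun e => Q (t e) (u e)).
Proof.
intros HQ Ht Hu; now apply (definable3_app (Q := fun x y _ => Q x y) HQ Ht Hu Hu).
Qed.

Lemma definable1_app Q t :
  definable1 Q -> is_term t -> definable (fun e => Q (t e)).
Proof.
intros HQ Ht; now apply (definable2_app (Q := fun x _ => Q x) HQ Ht Ht).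
Qed.

Lemma definable_mem t u :
  is_term t -> is_term u -> definable (fun e => E (t e) (u e)).
Proof.
apply definable2_app; now exists (fMem 0 1), inl.
Qed.

Lemma definable_eq t u :
  is_term t -> is_term u -> definable (fun e => t e = u e).
Proof.
apply (definable2_app (Q := fun x y => x = y)); now exists (fEq 0 1), inl.
Qed.

Lemma definable_False : definable (fun _ => False).
Proof. now exists fBot, inl. Qed.

(** The variables of the two formulas are made disjoint by sending them to the
    even and to the odd numbers. *)
Lemma definable_imp phi psi :
  definable phi -> definable psi -> definable (fun e => phi e -> psi e).
Proof.
intros [A [s HA]] [B [s' HB]].
exists (fImp (rename (fun n => 2 * n) A) (rename (fun n => S (2 * n)) B)).
exists (fun n => if Nat.even n then s (Nat.div2 n) else s' (Nat.div2 n)).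
intro e; cbn [sat]; rewrite !sat_rename.
rewrite <- HA, <- HB.
replace (fun n => look e (if Nat.even (2 * n) then s (Nat.div2 (2 * n))
  else s' (Nat.div2 (2 * n)))) with (fun n => look e (s n)).
2:{ apply functional_extensionality; intro n.
    now rewrite Nat.even_even, Nat.div2_double. }
replace (fun n => look e (if Nat.even (S (2 * n)) then s (Nat.div2 (S (2 * n)))
  else s' (Nat.div2 (S (2 * n))))) with (fun n => look e (s' n)); [tauto|].
apply functional_extensionality; intro n.
now rewrite Nat.even_succ, Nat.odd_even, Nat.div2_succ_double.
Qed.

(** Entry 0 of the environment is the variable to be bound, yet [s] may name it
    at any index; this moves it to index 0, where a quantifier or an axiom scheme
    binds it. *)
Lemma bound_variable (s : nat -> nat + U) :
  exists (r : nat -> nat) (s' : nat -> nat + U), forall x e,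
    (fun n => look (scons x e) (s n)) =
    (fun n => scons x (fun m => look e (s' m)) (r n)).
Proof.
exists (fun n => match s n with inl 0 => 0 | _ => S n end).
exists (fun n => match s n with inl (S i) => inl i | a => a end).
intros x e; apply functional_extensionality; intro n.
destruct (s n) as [[|i]|c] eqn:Hn; simpl; now rewrite ?Hn.
Qed.

Lemma definable_all (phi : U -> (nat -> U) -> Prop) :
  definable (fun e => phi (e 0) (fun n => e (S n))) ->
  definable (fun e => forall x, phi x e).
Proof.
intros [A [s H]]; destruct (bound_variable s) as [r [s' Hr]].
exists (fAll (rename r A)), s'; intro e; cbn [sat].
split; intros K x.
- specialize (K x); rewrite sat_rename, <- Hr in K; now apply H in K.
- rewrite sat_rename, <- Hr; apply H, K.
Qed.

Lemma definable_not phi : definable phi -> definable (fun e => ~ phi e).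
Proof. intro H; exact (definable_imp H definable_False). Qed.

Lemma definable_ex (phi : U -> (nat -> U) -> Prop) :
  definable (fun e => phi (e 0) (fun n => e (S n))) ->
  definable (fun e => exists x, phi x e).
Proof.
intro H.
apply (definable_ext (phi := fun e => ~ forall x, ~ phi x e)).
- apply definable_not, (@definable_all (fun x e => ~ phi x e)).
  exact (definable_not H).
- intro e; split; [apply not_all_not_ex|now intros [x Hx] K; apply (K x)].
Qed.

Lemma definable_and phi psi :
  definable phi -> definable psi -> definable (fun e => phi e /\ psi e).
Proof.
intros H K; apply (definable_ext (phi := fun e => ~ (phi e -> ~ psi e))).
- apply definable_not, definable_imp; [exact H|now apply definable_not].
- intro e; tauto.
Qed.

Lemma definable_or phi psi :
  definable phi -> definable psi -> definable (fun e => phi e \/ psi e).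
Proof.
intros H K; apply (definable_ext (phi := fun e => ~ phi e -> psi e)).
- apply definable_imp; [now apply definable_not|exact K].
- intro e; tauto.
Qed.

Lemma definable_iff phi psi :
  definable phi -> definable psi -> definable (fun e => phi e <-> psi e).
Proof.
intros H K; now apply definable_and; apply definable_imp.
Qed.

End Definability.

Ltac is_term_tac :=
  first [assumption | apply is_term_var | apply is_term_const
        | apply is_term_shift; is_term_tac].

(** Extended below with the predicates that have a definability lemma. *)
Ltac definable_atom := fail.

(** Descends through the syntax of a predicate.  Implication is tried before the
    universal quantifier, since both are products. *)
Ltac definability :=
  cbv beta;
  lazymatch goal with
  | |- definable _ (fun e => ~ _) => apply definable_not; definability
  | |- definable _ (fun e => _ /\ _) => apply definable_and; definability
  | |- definable _ (fun e => _ \/ _) => apply definable_or; definability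
  | |- definable _ (fun e => _ <-> _) => apply definable_iff; definability
  | |- definable _ (fun e => ex _) => apply definable_ex; definability
  | |- definable _ (fun e => False) => apply definable_False
  | |- definable1 _ _ => unfold definable1; definability
  | |- definable2 _ _ => unfold definable2; definability
  | |- definable3 _ _ => unfold definable3; definability
  | H : definable1 _ ?Q |- definable _ (fun e => ?Q _) =>
      apply (definable1_app H); is_term_tac
  | H : definable2 _ ?Q |- definable _ (fun e => ?Q _ _) =>
      apply (definable2_app H); is_term_tac
  | H : definable3 _ ?Q |- definable _ (fun e => ?Q _ _ _) =>
      apply (definable3_app H); is_term_tac
  | |- _ =>
    first [ apply definable_mem; is_term_tac
          | apply definable_eq; is_term_tac
          | definable_atom
          | apply definable_imp; definability
          | apply definable_all; definability ]
  end.

Section DefinableNotions.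
Context {U : Type} (E : U -> U -> Prop).

Lemma definable_same : definable2 E (same E).
Proof. unfold same; definability. Qed.

Lemma definable_subset : definable2 E (subset E).
Proof. unfold subset; definability. Qed.

Lemma definable_upair : definable3 E (is_upair E).
Proof. unfold is_upair, same; definability. Qed.

Lemma definable_opair : definable3 E (is_opair E).
Proof. unfold is_opair, is_upair, same; definability. Qed.

Lemma definable_related : definable3 E (related E).
Proof. unfold related, is_opair, is_upair, same; definability. Qed.

End DefinableNotions.

Ltac definable_atom ::=
  first [ apply (definable2_app (@definable_same _ _)); is_term_tac
        | apply (definable2_app (@definable_subset _ _)); is_term_tac
        | apply (definable3_app (@definable_upair _ _)); is_term_tac
        | apply (definable3_app (@definable_opair _ _)); is_term_tac
        | apply (definable3_app (@definable_related _ _)); is_term_tac ].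

(** * Ordered pairs *)

Section OrderedPairs.
Context {U : Type} (E : U -> U -> Prop).

Lemma same_refl x : same E x x.
Proof. intro z; tauto. Qed.

Lemma same_sym x y : same E x y -> same E y x.
Proof. intros H z; symmetry; apply H. Qed.

Lemma same_trans x y z : same E x y -> same E y z -> same E x z.
Proof. intros H K w; split; intro L; [apply K, H, L|apply H, K, L]. Qed.

Lemma is_upair_sub c c' a b a' b' x :
  is_upair E c a b -> is_upair E c' a' b' -> same E c c' ->
  same E x a \/ same E x b -> same E x a' \/ same E x b'.
Proof. intros H H' K Hx; apply H', K, H, Hx. Qed.

Lemma is_upair_same c c' a b a' b' :
  is_upair E c a b -> is_upair E c' a' b' -> same E a a' -> same E b b' ->
  same E c c'.
Proof.
intros H H' Ha Hb z; rewrite (H z), (H' z).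
split; intros [K|K]; eauto using same_sym, same_trans.
Qed.

Lemma is_opair_same z z' a b a' b' :
  is_opair E z a b -> is_opair E z' a' b' -> same E a a' -> same E b b' ->
  same E z z'.
Proof.
intros [u [v [Hu [Hv Hz]]]] [u' [v' [Hu' [Hv' Hz']]]] Ha Hb.
apply (is_upair_same Hz Hz'); eauto using is_upair_same.
Qed.

Lemma is_opair_inj z z' a b a' b' :
  is_opair E z a b -> is_opair E z' a' b' -> same E z z' ->
  same E a a' /\ same E b b'.
Proof.
intros [u [v [Hu [Hv Hz]]]] [u' [v' [Hu' [Hv' Hz']]]] K.
assert (L := same_sym K).
pose proof (fun x => is_upair_sub (x := x) Hu Hu').
pose proof (fun x => is_upair_sub (x := x) Hu Hv').
pose proof (fun x => is_upair_sub (x := x) Hv Hu').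
pose proof (fun x => is_upair_sub (x := x) Hv Hv').
pose proof (fun x => is_upair_sub (x := x) Hv' Hu).
pose proof (fun x => is_upair_sub (x := x) Hv' Hv).
assert (Ka : same E a a').
{ destruct (is_upair_sub (x := u) Hz Hz' K (or_introl (same_refl u))) as [M|M].
  - destruct (H a M (or_introl (same_refl a))); assumption.
  - destruct (is_upair_sub (x := a') Hv' Hu (same_sym M) (or_introl (same_refl a')));
      now apply same_sym. }
split; [exact Ka|].
destruct (is_upair_sub (x := v) Hz Hz' K (or_intror (same_refl v))) as [M|M].
- (* v = {a'}, so a = b, and then {a', b'}, being u or v, is {a} *)
  assert (Kb : same E b a').
  { destruct (is_upair_sub (x := b) Hv Hu' M (or_intror (same_refl b))); assumption. }
  assert (Kb' : same E b' a \/ same E b' b).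
  { destruct (is_upair_sub (x := v') Hz' Hz L (or_intror (same_refl v'))) as [N|N].
    - left; destruct (is_upair_sub (x := b') Hv' Hu N (or_intror (same_refl b')));
        assumption.
    - apply (is_upair_sub (x := b') Hv' Hv N), or_intror, same_refl. }
  destruct Kb'; eauto using same_sym, same_trans.
- destruct (is_upair_sub (x := b) Hv Hv' M (or_intror (same_refl b))) as [N|N];
    [|exact N].
  destruct (is_upair_sub (x := b') Hv' Hv (same_sym M) (or_intror (same_refl b')));
    eauto using same_sym, same_trans.
Qed.

Lemma is_upair_cong c a b a' b' :
  is_upair E c a b -> same E a a' -> same E b b' -> is_upair E c a' b'.
Proof.
intros H Ha Hb z; rewrite (H z).
split; intros [K|K]; eauto using same_sym, same_trans.
Qed.

Lemma is_opair_cong z a b a' b' :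
  is_opair E z a b -> same E a a' -> same E b b' -> is_opair E z a' b'.
Proof.
intros [u [v [Hu [Hv Hz]]]] Ha Hb; exists u, v.
eauto using is_upair_cong.
Qed.

End OrderedPairs.

(** * Sets and classes of the model *)

Section InsideV.
Variable V : transitive_model.
Local Infix "∈" := (mem (V := V)) (at level 70).

Lemma mem_ext (x y : V) : (forall z, z ∈ x <-> z ∈ y) -> x = y.
Proof. apply (ZF_extensionality (mem_ZF V)). Qed.

Lemma same_mem_eq (x y : V) : same mem x y <-> x = y.
Proof. split; [apply mem_ext|intros ->; apply same_refl]. Qed.

Lemma opair_unique (z z' a b : V) :
  is_opair mem z a b -> is_opair mem z' a b -> z = z'.
Proof.
intros H K; apply same_mem_eq.
apply (is_opair_same H K); apply same_refl.
Qed.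

Lemma opair_inj (z a b a' b' : V) :
  is_opair mem z a b -> is_opair mem z a' b' -> a = a' /\ b = b'.
Proof.
intros H K; rewrite <- !same_mem_eq; apply (is_opair_inj H K), same_refl.
Qed.

Lemma opair_exists (a b : V) : exists z, is_opair mem z a b.
Proof.
assert (H : forall x y : V, exists c, is_upair mem c x y).
{ intros x y; destruct (ZF_pairing (mem_ZF V) x y) as [c Hc]; exists c.
  intro z; now rewrite !same_mem_eq. }
destruct (H a a) as [u Hu], (H a b) as [v Hv], (H u v) as [z Hz].
now exists z, u, v.
Qed.

Lemma opair_related (r z a b : V) :
  is_opair mem z a b -> (related mem r a b <-> z ∈ r).
Proof.
intro H; split; [|now exists z].
intros [z' [K Hz']]; now rewrite (opair_unique H K).
Qed.

Definition is_set (Q : V -> Prop) := exists w, forall z, z ∈ w <-> Q z.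

Lemma is_set_ext Q Q' : is_set Q -> (forall z, Q z <-> Q' z) -> is_set Q'.
Proof. intros [w H] K; exists w; intro z; now rewrite H. Qed.

Lemma is_set_elements a : is_set (fun z => z ∈ a).
Proof. now exists a. Qed.

Lemma is_set_bounded (B Q : V -> Prop) :
  definable1 mem Q -> is_set B -> (forall z, Q z -> B z) -> is_set Q.
Proof.
intros [A [s H]] [a Ha] Hb.
destruct (bound_variable s) as [r [s' Hr]].
destruct (ZF_separation (mem_ZF V) (rename r A) (fun n => look (fun _ => a) (s' n)) a)
  as [w Hw].
exists w; intro z; rewrite Hw, sat_rename, <- Hr, H; simpl; rewrite Ha.
split; [tauto|auto].
Qed.

Lemma is_set_functional Q : (forall z z' : V, Q z -> Q z' -> z = z') -> is_set Q.
Proof.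
intro H; destruct (classic (exists z, Q z)) as [[z Hz]|K].
- destruct (ZF_pairing (mem_ZF V) z z) as [w Hw]; exists w; intro x; rewrite Hw.
  split; [intros [->| ->]; exact Hz|intro Hx; left; now apply H].
- destruct (ZF_infinity (mem_ZF V)) as [_ [[o [_ Ho]] _]].
  exists o; intro x; split; [intro Hx; now destruct (Ho x)|].
  intro Hx; destruct K; now exists x.
Qed.

(** The replacement scheme binds the argument at index 1 and the value at index
    0, hence two uses of [bound_variable]. *)
Lemma is_set_image (Q : V -> V -> Prop) a :
  definable2 mem Q ->
  (forall x y y', x ∈ a -> Q x y -> Q x y' -> y = y') ->
  is_set (fun y => exists x, x ∈ a /\ Q x y).
Proof.
intros HQ Hf.
assert (HQ' : definable mem (fun e => Q (e 1) (e 0))) by definability.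
destruct HQ' as [A [s H]].
destruct (bound_variable s) as [r [s' Hr]].
destruct (bound_variable s') as [r' [s'' Hr']].
pose (A' := rename (fun n => match n with O => O | S m => S (r' m) end) (rename r A)).
pose (e := fun n => look (fun _ => a) (s'' n)).
assert (K : forall x y, sat mem (scons y (scons x e)) A' <-> Q x y).
{ intros x y.
  change (Q x y) with ((fun e => Q (e 1) (e 0)) (scons y (scons x (fun _ => a)))).
  rewrite <- H, Hr, Hr'; unfold A'; rewrite !sat_rename.
  match goal with |- sat _ ?f _ <-> sat _ ?g _ => replace f with g; [tauto|] end.
  apply functional_extensionality; intro n; now destruct (r n). }
destruct (ZF_replacement (mem_ZF V) (A := A') (e := e) (a := a)) as [w Hw].
- intros x y y' Hx; rewrite !K; now apply Hf.
- exists w; intro y; rewrite Hw; split; intros [x Hx]; exists x.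
  + now rewrite K in Hx.
  + now rewrite K.
Qed.

(** Extensionality makes the set [w] that collects [Q x] unique, so replacement
    applies to the map from [x] to [w]. *)
Lemma is_set_bigunion (Q : V -> V -> Prop) a :
  definable2 mem Q -> (forall x, x ∈ a -> is_set (Q x)) ->
  is_set (fun z => exists x, x ∈ a /\ Q x z).
Proof.
intros HQ Hs.
destruct (is_set_image (Q := fun x w => forall z, z ∈ w <-> Q x z) (a := a))
  as [b Hb].
- definability.
- intros x y y' _ H K; apply mem_ext; intro z; now rewrite H.
- destruct (ZF_union (mem_ZF V) b) as [u Hu]; exists u; intro z; rewrite Hu.
  split.
  + intros [w [Hw Hz]]; apply Hb in Hw; destruct Hw as [x [Hx Hw]].
    exists x; split; [exact Hx|now apply Hw].
  + intros [x [Hx Hz]]; destruct (Hs x Hx) as [w Hw].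
    exists w; split; [|now apply Hw].
    apply Hb; now exists x.
Qed.

Lemma is_set_or (Q Q' : V -> Prop) :
  is_set Q -> is_set Q' -> is_set (fun z => Q z \/ Q' z).
Proof.
intros [a Ha] [b Hb].
destruct (ZF_pairing (mem_ZF V) a b) as [c Hc].
destruct (ZF_union (mem_ZF V) c) as [u Hu]; exists u; intro z.
rewrite Hu; split.
- intros [y [Hy Hz]]; apply Hc in Hy; destruct Hy as [-> | ->].
  + left; now apply Ha.
  + right; now apply Hb.
- intros [Hz|Hz]; [exists a|exists b]; rewrite Hc, ?Ha, ?Hb; tauto.
Qed.

Lemma is_set_insert a x : is_set (fun z => z ∈ a \/ z = x).
Proof.
apply is_set_or; [apply is_set_elements|].
apply is_set_functional; now intros z z' -> ->.
Qed.

Lemma is_set_product (Q Q' : V -> Prop) :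
  is_set Q -> is_set Q' ->
  is_set (fun z => exists x y, Q x /\ Q' y /\ is_opair mem z x y).
Proof.
intros [a Ha] [b Hb].
apply (is_set_ext (Q := fun z => exists x, x ∈ a /\
  exists y, y ∈ b /\ is_opair mem z x y)).
- apply is_set_bigunion with (Q := fun x z => exists y, y ∈ b /\ is_opair mem z x y).
  + definability.
  + intros x _; apply is_set_image with (Q := fun y z => is_opair mem z x y).
    * definability.
    * intros y z z' _; apply opair_unique.
- intro z; split; intros [x H].
  + destruct H as [Hx [y [Hy Hz]]]; exists x, y; now rewrite <- Ha, <- Hb.
  + destruct H as [y [Hx [Hy Hz]]]; exists x; rewrite Ha; split; [exact Hx|].
    exists y; now rewrite Hb.
Qed.

Lemma is_set_subsets a : is_set (fun z => subset mem z a).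
Proof. exact (ZF_power (mem_ZF V) a). Qed.

(** By induction on membership.  Without choice one cannot pick a transitive set
    around each member of [x], but the least such sets are definable, and their
    union with [x] added is transitive. *)
Lemma transitive_superset (x : V) : exists d, transitive_set mem d /\ x ∈ d.
Proof.
induction x as [x IH] using (well_founded_ind (mem_wf V)).
pose (least := fun y z => forall d, transitive_set mem d -> y ∈ d -> z ∈ d).
assert (Hl : definable2 mem least).
{ unfold least, transitive_set; definability. }
assert (Hu : is_set (fun z => exists y, y ∈ x /\ least y z)).
{ apply is_set_bigunion; [exact Hl|].
  intros y Hy; destruct (IH y Hy) as [d [Hd Hyd]].
  apply is_set_bounded with (B := fun z => z ∈ d).
  - definability.
  - apply is_set_elements.
  - intros z Hz; now apply Hz. }
destruct Hu as [u Hu], (is_set_insert u x) as [d Hd].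
exists d; split; [|apply Hd; now right].
intros z Hz w Hw; apply Hd; left; apply Hu; apply Hd in Hz; rewrite Hu in Hz.
destruct Hz as [[y [Hy Hz]]| ->].
- exists y; split; [exact Hy|]; intros c Hc Hyc.
  now apply (Hc z (Hz c Hc Hyc)).
- exists w; split; [exact Hw|]; now intros c _ Hc.
Qed.

Lemma transitive_superset2 (x y : V) :
  exists d, transitive_set mem d /\ x ∈ d /\ y ∈ d.
Proof.
destruct (ZF_pairing (mem_ZF V) x y) as [c Hc].
destruct (transitive_superset c) as [d [Hd Hcd]].
exists d; split; [exact Hd|split]; apply (Hd c Hcd), Hc; tauto.
Qed.

Lemma transitive_related (d r a b : V) :
  transitive_set mem d -> r ∈ d -> related mem r a b -> a ∈ d /\ b ∈ d.
Proof.
intros Hd Hr [z [[u [v [_ [Hv Hz]]]] Hzr]].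
assert (Hvz : v ∈ z) by (apply Hz; right; apply same_refl).
assert (Hvd : v ∈ d) by (apply (Hd z (Hd r Hr z Hzr)), Hvz).
split; apply (Hd v Hvd), Hv; [left|right]; apply same_refl.
Qed.

End InsideV.

(** * The collapse as an embedding *)

Section Collapse.
Variable V : transitive_model.
Local Infix "∈" := (mem (V := V)) (at level 70).

Lemma emb_inj (x y : V) : set_eq (emb x) (emb y) -> x = y.
Proof.
revert y; induction x as [x IH] using (well_founded_ind (mem_wf V)).
intros y H; apply set_eq_same in H; apply mem_ext; intro z; split; intro Hz.
- destruct (proj1 (set_mem_emb y (emb z))) as [w [Hw K]].
  + apply H, set_mem_emb; exists z; split; [exact Hz|apply set_eq_refl].
  + now rewrite (IH z Hz w K).
- destruct (proj1 (set_mem_emb x (emb z))) as [w [Hw K]].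
  + apply H, set_mem_emb; exists z; split; [exact Hz|apply set_eq_refl].
  + now rewrite <- (IH w Hw z (set_eq_sym K)).
Qed.

Lemma emb_mem (x y : V) : set_mem (emb x) (emb y) <-> x ∈ y.
Proof.
rewrite set_mem_emb; split.
- intros [z [Hz H]]; now rewrite (emb_inj H).
- intro H; exists x; split; [exact H|apply set_eq_refl].
Qed.

Lemma emb_upair (c a b : V) :
  is_upair mem c a b -> is_upair set_mem (emb c) (emb a) (emb b).
Proof.
intros H z; rewrite set_mem_emb, <- !set_eq_same; split.
- intros [y [Hy K]]; apply H in Hy; rewrite !same_mem_eq in Hy.
  destruct Hy as [-> | ->]; tauto.
- intros [K|K]; [exists a|exists b]; (split; [apply H|exact K]).
  + left; apply same_refl.
  + right; apply same_refl.
Qed.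

Lemma emb_opair (z a b : V) :
  is_opair mem z a b -> is_opair set_mem (emb z) (emb a) (emb b).
Proof.
intros [u [v [Hu [Hv Hz]]]].
exists (emb u), (emb v); now repeat split; apply emb_upair.
Qed.

Lemma opair_emb x y w (z a b : V) :
  is_opair mem z a b -> is_opair set_mem x y w ->
  set_eq y (emb a) -> set_eq w (emb b) -> set_eq x (emb z).
Proof.
intros Hz Hx; rewrite !set_eq_same; exact (is_opair_same Hx (emb_opair Hz)).
Qed.

Lemma opair_emb_inv x y w (z a b : V) :
  is_opair mem z a b -> is_opair set_mem x y w -> set_eq x (emb z) ->
  set_eq y (emb a) /\ set_eq w (emb b).
Proof.
intros Hz Hx; rewrite !set_eq_same; exact (is_opair_inj Hx (emb_opair Hz)).
Qed.

Lemma opair_of_emb y (z a b : V) :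
  is_opair mem z a b -> set_eq y (emb z) -> is_opair set_mem y (emb a) (emb b).
Proof.
intros Hz; rewrite set_eq_same; intro Hy.
destruct (emb_opair Hz) as [u [v [Hu [Hv Hc]]]]; exists u, v.
split; [exact Hu|split; [exact Hv|]]; intro w; rewrite <- (Hc w); apply Hy.
Qed.

End Collapse.

(** * Forcing equations between names and sets of the model *)

Section ForcingRelation.
Variables (V : transitive_model) (P : forcing V).
Local Infix "∈" := (mem (V := V)) (at level 70).

Lemma definable_le : definable2 mem (le P).
Proof. unfold le; definability. Qed.

Definition compatible (q p : V) := exists r, r ∈ cond P /\ le P r q /\ le P r p.

(** [Q] is dense below [p]. *)
Definition densely (Q : V -> Prop) (p : V) :=
  forall q, q ∈ cond P -> le P q p -> exists q', q' ∈ cond P /\ le P q' q /\ Q q'.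

Lemma densely_mono (Q Q' : V -> Prop) p :
  (forall q, q ∈ cond P -> Q q -> Q' q) -> densely Q p -> densely Q' p.
Proof.
intros H Hp q Hq Hqp; destruct (Hp q Hq Hqp) as [q' [Hq' [Hle HQ]]].
exists q'; auto.
Qed.

Lemma densely_below (Q : V -> Prop) p q :
  p ∈ cond P -> q ∈ cond P -> le P q p -> densely Q p -> densely Q q.
Proof.
intros Hp Hq Hqp H r Hr Hrq; apply H; [exact Hr|now apply le_trans with q].
Qed.

Lemma generic_cond G p : generic P G -> G p -> p ∈ cond P.
Proof. intros [H _]; apply H. Qed.

Lemma generic_top G : generic P G -> G (top P).
Proof. now intros [_ [H _]]. Qed.

Lemma generic_up G p q : generic P G -> G p -> q ∈ cond P -> le P p q -> G q.
Proof. intros [_ [_ [H _]]]; apply H. Qed.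

Lemma generic_directed G p q :
  generic P G -> G p -> G q -> exists r, G r /\ le P r p /\ le P r q.
Proof. intros [_ [_ [_ [H _]]]]; apply H. Qed.

Lemma generic_compatible G p q : generic P G -> G p -> G q -> compatible p q.
Proof.
intros HG Hp Hq; destruct (generic_directed HG Hp Hq) as [r [Hr H]].
exists r; split; [exact (generic_cond HG Hr)|exact H].
Qed.

(** The conditions that satisfy [Q], or that no strengthening of which satisfies
    [Q], are dense.  Applied to the failure of a statement, this yields a
    condition of [G] below which the statement never fails. *)
Lemma generic_decides G (Q : V -> Prop) :
  generic P G -> definable1 mem Q ->
  exists p, G p /\ (Q p \/ forall q, q ∈ cond P -> le P q p -> ~ Q q).
Proof.
intros HG HQ.
destruct (is_set_bounded (B := fun p => p ∈ cond P) (Q := fun p => p ∈ cond P /\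
    (Q p \/ forall q, q ∈ cond P -> le P q p -> ~ Q q))) as [D HD].
- pose proof definable_le; definability.
- apply is_set_elements.
- tauto.
- destruct HG as [_ [_ [_ [_ HG]]]].
  destruct (HG D) as [p [Hp HpD]].
  + split; [intros p Hp; now apply HD in Hp|]; intros p Hp.
    destruct (classic (exists q, q ∈ cond P /\ le P q p /\ Q q))
      as [[q [Hq [Hle HQq]]]|K].
    * exists q; split; [apply HD; tauto|exact Hle].
    * exists p; split; [|now apply le_refl].
      apply HD; split; [exact Hp|right]; intros q Hq Hle HQq.
      apply K; now exists q.
  + exists p; split; [exact Hp|now apply HD in HpD].
Qed.

Lemma generic_densely G (Q : V -> Prop) p :
  generic P G -> definable1 mem Q -> G p -> densely Q p -> exists q, G q /\ Q q.
Proof.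
intros HG HQ Hp H.
destruct (generic_decides HG HQ) as [q [Hq [K|K]]]; [now exists q|].
destruct (generic_directed HG Hp Hq) as [r [Hr [Hrp Hrq]]].
assert (Hrc := generic_cond HG Hr).
destruct (H r Hrc Hrp) as [q' [Hq' [Hle HQ']]].
destruct (K q'); [exact Hq'| |exact HQ'].
apply le_trans with r; auto; now apply (generic_cond HG).
Qed.

(** The recursion for [p] forcing that [s] equals [a], where [R u q b] stands for
    [q] forcing that [u] equals [b]: whatever is put into [s] is densely equal to
    an element of [a], and every element of [a] is densely put into [s].  [R]
    occurs only positively. *)
Definition equal_step (R : V -> V -> V -> Prop) (s p a : V) :=
  p ∈ cond P /\
  (forall u r, related mem s u r -> r ∈ cond P ->
    forall q, q ∈ cond P -> le P q p -> le P q r ->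
    densely (fun q' => exists b, b ∈ a /\ R u q' b) q) /\
  (forall b, b ∈ a ->
    densely (fun q' => exists u r, related mem s u r /\ r ∈ cond P /\ le P q' r /\
      R u q' b) p).

Lemma equal_step_mono (R R' : V -> V -> V -> Prop) s p a :
  (forall u r q b, related mem s u r -> q ∈ cond P -> b ∈ a -> R u q b -> R' u q b) ->
  equal_step R s p a -> equal_step R' s p a.
Proof.
intros H [Hp [H1 H2]]; split; [exact Hp|split].
- intros u r Hur Hr q Hq Hqp Hqr.
  apply (densely_mono (Q := fun q' => exists b, b ∈ a /\ R u q' b)); [|eauto].
  intros q' Hq' [b [Hb K]]; eauto.
- intros b Hb; apply (densely_mono (Q := fun q' => exists u r,
    related mem s u r /\ r ∈ cond P /\ le P q' r /\ R u q' b)); [|auto].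
  intros q Hq [u [r [Hur [Hr [Hle K]]]]]; exists u, r; eauto 6.
Qed.

Definition triple (X s p a : V) := exists w, is_opair mem w p a /\ related mem X s w.

(** The greatest fixed point of [equal_step].  A set [X] of triples that justify
    each other replaces the transfinite recursion in [V], so that the relation is
    visibly first-order.  As names are well-founded there is only one fixed
    point, the usual forcing relation. *)
Definition forces_eq (s p a : V) :=
  exists X, triple X s p a /\
    forall s' p' a', triple X s' p' a' -> equal_step (triple X) s' p' a'.

Lemma definable_forces_eq : definable3 mem forces_eq.
Proof.
pose proof definable_le.
unfold forces_eq, equal_step, triple, densely; definability.
Qed.

Lemma forces_eq_unfold s p a : forces_eq s p a -> equal_step forces_eq s p a.
Proof.
intros [X [HX K]]; apply equal_step_mono with (2 := K _ _ _ HX).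
intros u r q b _ _ _ Hu; now exists X.
Qed.

(** A step from [(s, p, a)] leads to an earlier name [u] and an element [b] of
    [a], so it stays inside a transitive set [d] containing [s] and [a].  The part
    of the class [forces_eq] over [d] is thus a set justifying [(s, p, a)]. *)
Lemma forces_eq_fold s p a : equal_step forces_eq s p a -> forces_eq s p a.
Proof.
intro H.
destruct (transitive_superset2 s a) as [d [Hd [Hs Ha]]].
destruct (is_set_bounded
  (B := fun z => exists x y, x ∈ d /\ (exists q b, q ∈ cond P /\ b ∈ d /\
     is_opair mem y q b) /\ is_opair mem z x y)
  (Q := fun z => exists x y, x ∈ d /\ (exists q b, q ∈ cond P /\ b ∈ d /\
     is_opair mem y q b /\ equal_step forces_eq x q b) /\ is_opair mem z x y))
  as [X HX].
- pose proof definable_le as Dle; pose proof definable_forces_eq as Deq.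
  unfold equal_step, densely; definability.
- apply is_set_product; [|apply is_set_product]; apply is_set_elements.
- intros z [x [y [Hx [[q [b [Hq [Hb [Hy _]]]]] Hz]]]].
  exists x, y; split; [exact Hx|split; [|exact Hz]]; now exists q, b.
- assert (K : forall x q b, triple X x q b <->
    x ∈ d /\ b ∈ d /\ equal_step forces_eq x q b).
  { intros x q b; split.
    - intros [y [Hy [z [Hz HzX]]]]; apply HX in HzX.
      destruct HzX as [x' [y' [Hx [[q' [b' [Hq [Hb [Hy' L]]]]] Hz']]]].
      destruct (opair_inj Hz Hz') as [<- <-].
      destruct (opair_inj Hy Hy') as [<- <-]; tauto.
    - intros [Hx [Hb L]].
      destruct (opair_exists q b) as [y Hy], (opair_exists x y) as [z Hz].
      exists y; split; [exact Hy|exists z; split; [exact Hz|]].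
      apply HX; exists x, y; split; [exact Hx|split; [|exact Hz]].
      exists q, b; split; [apply L|tauto]. }
  exists X; split; [now apply K|].
  intros x q b HxX; apply K in HxX; destruct HxX as [Hx [Hb L]].
  apply equal_step_mono with (2 := L).
  intros u r q' c Hu Hq' Hc M; apply K; split; [|split].
  + now apply (transitive_related Hd Hx Hu).
  + now apply (Hd b Hb).
  + now apply forces_eq_unfold.
Qed.

Lemma forces_eq_below s p q a :
  q ∈ cond P -> le P q p -> forces_eq s p a -> forces_eq s q a.
Proof.
intros Hq Hqp H; apply forces_eq_fold.
destruct (forces_eq_unfold H) as [Hp [H1 H2]].
split; [exact Hq|split].
- intros u r Hur Hr q' Hq' Hq'q; apply H1; auto; now apply le_trans with q.
- intros b Hb; apply densely_below with p; auto.
Qed.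

Definition forces_mem (t p a : V) :=
  exists u r, related mem t u r /\ r ∈ cond P /\ le P p r /\ forces_eq u p a.

Lemma definable_forces_mem : definable3 mem forces_mem.
Proof.
pose proof definable_le as Dle; pose proof definable_forces_eq as Deq.
unfold forces_mem; definability.
Qed.

Lemma forces_mem_below t p q a :
  p ∈ cond P -> q ∈ cond P -> le P q p -> forces_mem t p a -> forces_mem t q a.
Proof.
intros Hp Hq Hqp [u [r [Hur [Hr [Hpr H]]]]]; exists u, r.
split; [exact Hur|split; [exact Hr|split]].
- now apply le_trans with p.
- now apply forces_eq_below with p.
Qed.

(** Stated relative to the truth lemma for the components of [t], for use within
    the induction that proves the latter. *)
Lemma truth_mem_of_eq G t a :
  generic P G ->
  (forall u r, related mem t u r -> (set_eq (val G u) (emb a) <->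
     exists p, G p /\ forces_eq u p a)) ->
  (set_mem (emb a) (val G t) <-> exists p, G p /\ forces_mem t p a).
Proof.
intros HG H; rewrite set_mem_val; split.
- intros [u [r [Hr [Hur Ha]]]].
  apply set_eq_sym, (H u r Hur) in Ha; destruct Ha as [p [Hp Ha]].
  destruct (generic_directed HG Hp Hr) as [q [Hq [Hqp Hqr]]].
  exists q; split; [exact Hq|]; exists u, r.
  split; [exact Hur|split; [exact (generic_cond HG Hr)|split; [exact Hqr|]]].
  apply forces_eq_below with p; auto; exact (generic_cond HG Hq).
- intros [p [Hp [u [r [Hur [Hr [Hpr Ha]]]]]]]; exists u, r; split; [|split].
  + now apply (generic_up HG Hp).
  + exact Hur.
  + apply set_eq_sym, (H u r Hur); now exists p.
Qed.

(** The truth lemma, by induction on [s].  If [s] evaluates to [a], consider the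
    two ways in which a condition can refute [equal_step]: it puts into [s]
    something that it keeps away from every element of [a], or it keeps some
    element of [a] out of [s].  By induction no condition of [G] does either, so a
    condition of [G] has no refuting strengthening and satisfies [equal_step].
    Conversely [G] meets the sets that [equal_step] says are dense. *)
Theorem truth_eq G s a :
  generic P G -> (set_eq (val G s) (emb a) <-> exists p, G p /\ forces_eq s p a).
Proof.
intro HG; revert a.
induction s as [s IH] using (well_founded_ind (@subname_wf V)); intro a.
assert (Hmem : forall b, set_mem (emb b) (val G s) <->
    exists p, G p /\ forces_mem s p b).
{ intro b; apply (truth_mem_of_eq HG); intros u r Hur; apply IH; now exists r. }
pose proof definable_le as Dle; pose proof definable_forces_eq as Deq.
pose proof definable_forces_mem as Dmem.
split.
- intro Heq; rewrite set_eq_same in Heq.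
  destruct (generic_decides (G := G) (Q := fun q =>
     (exists u r, related mem s u r /\ r ∈ cond P /\ le P q r /\
        forall q', q' ∈ cond P -> le P q' q -> ~ exists b, b ∈ a /\ forces_eq u q' b) \/
     (exists b, b ∈ a /\ forall q', q' ∈ cond P -> le P q' q -> ~ forces_mem s q' b)))
    as [p [Hp [[K|K]|K]]]; [exact HG|definability|..].
  + exfalso; destruct K as [u [r [Hur [Hr [Hpr K]]]]].
    assert (Hu : set_mem (val G u) (emb a)).
    { apply Heq, set_mem_val; exists u, r; split; [|split].
      - now apply (generic_up HG Hp).
      - exact Hur.
      - apply set_eq_refl. }
    apply set_mem_emb in Hu; destruct Hu as [b [Hb Hu]].
    apply IH in Hu; [|now exists r]; destruct Hu as [q [Hq Hu]].
    destruct (generic_directed HG Hp Hq) as [q' [Hq' [Hq'p Hq'q]]].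
    assert (Hc := generic_cond HG Hq').
    apply (K q'); auto; exists b; split; [exact Hb|].
    now apply forces_eq_below with q.
  + exfalso; destruct K as [b [Hb K]].
    apply emb_mem, Heq, Hmem in Hb; destruct Hb as [q [Hq Hb]].
    destruct (generic_directed HG Hp Hq) as [q' [Hq' [Hq'p Hq'q]]].
    assert (Hc := generic_cond HG Hq').
    apply (K q'); auto; apply forces_mem_below with q; auto.
    exact (generic_cond HG Hq).
  + exists p; split; [exact Hp|]; apply forces_eq_fold.
    assert (Hpc := generic_cond HG Hp).
    split; [exact Hpc|split].
    * intros u r Hur Hr q Hq Hqp Hqr q' Hq' Hq'q.
      apply NNPP; intro L; apply (K q'); [exact Hq'|now apply le_trans with q|].
      left; exists u, r; split; [exact Hur|split; [exact Hr|split]].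
      { now apply le_trans with q. }
      intros q2 Hq2 Hq2q' M; apply L; now exists q2.
    * intros b Hb q Hq Hqp.
      apply NNPP; intro L; apply (K q Hq Hqp).
      right; exists b; split; [exact Hb|].
      intros q2 Hq2 Hq2q' M; apply L; now exists q2.
- intros [p [Hp Ha]]; destruct (forces_eq_unfold Ha) as [Hpc [H1 H2]].
  apply set_eq_same; intro x; split; intro Hx.
  + apply set_mem_val in Hx; destruct Hx as [u [r [Hr [Hur Hx]]]].
    destruct (generic_directed HG Hp Hr) as [q [Hq [Hqp Hqr]]].
    destruct (generic_densely HG (Q := fun q' => exists b, b ∈ a /\ forces_eq u q' b)
       (p := q)) as [q' [Hq' [b [Hb Hub]]]].
    * definability.
    * exact Hq.
    * apply (H1 u r); auto; now apply (generic_cond HG).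
    * apply set_mem_emb; exists b; split; [exact Hb|].
      apply set_eq_trans with (1 := Hx), IH; [now exists r|now exists q'].
  + apply set_mem_emb in Hx; destruct Hx as [b [Hb Hx]].
    apply set_mem_eq_l with (emb b); [now apply set_eq_sym|].
    apply Hmem, (generic_densely HG (p := p)); auto.
    * definability.
    * now apply H2.
Qed.

Corollary truth_mem G t a :
  generic P G -> (set_mem (emb a) (val G t) <-> exists p, G p /\ forces_mem t p a).
Proof.
intro HG; apply (truth_mem_of_eq HG); intros u r _; now apply truth_eq.
Qed.

End ForcingRelation.

(** * Distributivity prevents fresh functions *)

Section FunctionsIntoV.
Variables (V : transitive_model) (k : V).
Local Infix "∈" := (mem (V := V)) (at level 70).

Lemma set_mem_eq_r x y z : set_eq y z -> set_mem x y -> set_mem x z.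
Proof. rewrite set_eq_same; intro H; apply H. Qed.

Variable f : SET.
Hypothesis (f_function : function_on set_mem f (emb k))
  (f_values : forall a b, related set_mem f a b -> in_V V b).

Lemma function_value a :
  a ∈ k -> exists v z : V, is_opair mem z a v /\ set_mem (emb z) f.
Proof.
intro Ha; destruct f_function as [_ [Hf _]].
destruct (Hf (emb a)) as [b Hb]; [now apply emb_mem|].
destruct (f_values Hb) as [v Hv]; destruct Hb as [y [Hy Hyf]].
destruct (opair_exists a v) as [z Hz]; exists v, z; split; [exact Hz|].
apply set_mem_eq_l with (2 := Hyf).
exact (opair_emb Hz Hy (set_eq_refl _) Hv).
Qed.

Lemma function_element y :
  set_mem y f -> exists a v z : V, a ∈ k /\ is_opair mem z a v /\ set_eq y (emb z).
Proof.
intro Hy; destruct f_function as [Hf _].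
destruct (Hf y Hy) as [a' [b [Ha' Hab]]].
destruct (f_values (ex_intro _ y (conj Hab Hy))) as [v Hv].
apply set_mem_emb in Ha'; destruct Ha' as [a [Ha Haa]].
destruct (opair_exists a v) as [z Hz]; exists a, v, z.
split; [exact Ha|split; [exact Hz|exact (opair_emb Hz Hab Haa Hv)]].
Qed.

Lemma function_unique (a v z v' z' : V) :
  is_opair mem z a v -> is_opair mem z' a v' ->
  set_mem (emb z) f -> set_mem (emb z') f -> z = z'.
Proof.
intros Hz Hz' Hf Hf'; destruct f_function as [_ [_ K]].
assert (L : v = v').
{ apply emb_inj, set_eq_same, (K (emb a)).
  - exists (emb z); split; [now apply emb_opair|exact Hf].
  - exists (emb z'); split; [now apply emb_opair|exact Hf']. }
subst v'; exact (opair_unique Hz Hz').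
Qed.

End FunctionsIntoV.

Section NoFresh.
Variables (V : transitive_model) (P : forcing V).
Local Infix "∈" := (mem (V := V)) (at level 70).

(** [q] forces a value at each [b <= a].  With [b = a] included, deciding for all
    [a] in [k] decides the whole function even when [k] has a last element. *)
Definition decides (t q a : V) :=
  forall b, b ∈ a \/ b = a -> exists v z, is_opair mem z b v /\
    densely P (fun q' => forces_mem P t q' z) q.

Lemma definable_decides : definable3 mem decides.
Proof.
pose proof (definable_le P) as Dle; pose proof (definable_forces_mem P) as Dmem.
unfold decides, densely; definability.
Qed.

(** The restriction of [f] to [a], with the pair at [a] added, is a set [h] of
    [V].  A condition of [G] keeping some element of [h] out of [t] would
    contradict the truth lemma, so some condition of [G] has densely many
    strengthenings forcing each element of [h] into [t]. *)
Lemma generic_decides_below G t f (k a : V) :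
  generic P G -> set_eq f (val G t) -> transitive_set mem k -> fresh k f -> a ∈ k ->
  exists q, G q /\ decides t q a.
Proof.
intros HG Hft Hk [Hf [Hv [_ Hr]]] Ha.
destruct (Hr a Ha) as [g' [Hg' [g Hg]]].
destruct (function_value Hf Hv Ha) as [v0 [z0 [Hz0 Hz0f]]].
destruct (is_set_insert g z0) as [h Hh].
assert (Hhf : forall z, z ∈ h -> set_mem (emb z) f).
{ intros z Hz; apply Hh in Hz; destruct Hz as [Hz| ->]; [|exact Hz0f].
  apply Hg', (set_mem_eq_r (set_eq_sym Hg)), emb_mem, Hz. }
destruct (generic_decides (P := P) (G := G) (Q := fun q => exists z, z ∈ h /\
   forall q', q' ∈ cond P -> le P q' q -> ~ forces_mem P t q' z))
  as [p [Hp [[z [Hz K]]|K]]].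
- exact HG.
- pose proof (definable_le P) as Dle; pose proof (definable_forces_mem P) as Dmem; definability.
- exfalso; apply Hhf in Hz; apply (set_mem_eq_r Hft) in Hz.
  apply (truth_mem _ _ HG) in Hz; destruct Hz as [q [Hq Hz]].
  destruct (generic_directed HG Hp Hq) as [r [Hr' [Hrp Hrq]]].
  assert (Hc := generic_cond HG Hr').
  apply (K r); auto; apply forces_mem_below with q; auto.
  exact (generic_cond HG Hq).
- assert (Hd : forall z, z ∈ h -> densely P (fun q' => forces_mem P t q' z) p).
  { intros z Hz q Hq Hqp; apply NNPP; intro L; apply (K q Hq Hqp).
    exists z; split; [exact Hz|]; intros q' Hq' Hle M; apply L; now exists q'. }
  exists p; split; [exact Hp|]; intros b [Hb| ->].
  + destruct (function_value Hf Hv (Hk a Ha b Hb)) as [v [z [Hz Hzf]]].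
    exists v, z; split; [exact Hz|]; apply Hd, Hh; left.
    apply emb_mem, (set_mem_eq_r Hg), Hg'; split; [exact Hzf|].
    exists (emb b), (emb v); split; [now apply emb_mem|now apply emb_opair].
  + exists v0, z0; split; [exact Hz0|]; apply Hd, Hh; now right.
Qed.

Theorem descending_distributive_no_fresh k :
  ordinal mem k -> descending_distributive P k -> adds_no_fresh_functions P k.
Proof.
intros [Hk Hk'] HP G HG [f [[t Hft] Hfresh]].
pose proof (definable_le P) as Dle; pose proof (definable_forces_mem P) as Dmem.
pose proof definable_decides as Ddec.
destruct (generic_decides (P := P) (G := G) (Q := fun q => exists a, a ∈ k /\
   forall q', q' ∈ cond P -> le P q' q -> ~ decides t q' a))
  as [p0 [Hp0 [[a [Ha K]]|K]]]; [exact HG|definability| |].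
(* A condition of [G] deciding at [a] is compatible with [p0], so [p0] cannot
   exclude such decisions. *)
{ destruct (generic_decides_below HG Hft Hk Hfresh Ha) as [q [Hq Hqa]].
  destruct (generic_directed HG Hp0 Hq) as [r [Hr [Hrp Hrq]]].
  assert (Hc := generic_cond HG Hr).
  apply (K r); auto; intros b Hb; destruct (Hqa b Hb) as [v [z [Hz Hd]]].
  exists v, z; split; [exact Hz|].
  apply densely_below with q; auto; exact (generic_cond HG Hq). }
(* Conditions incompatible with [p0] are admitted so that density holds everywhere,
   not only below [p0]. *)
pose (In := fun a q => q ∈ cond P /\ (~ compatible P q p0 \/ decides t q a)).
assert (DIn : definable2 mem In).
{ unfold In, compatible; definability. }
destruct (is_set_image (Q := fun a w => exists D, (forall q, q ∈ D <-> In a q) /\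
   is_opair mem w a D) (a := k)) as [s Hs].
- definability.
- intros a w w' _ [D [HD Hw]] [D' [HD' Hw']].
  assert (D = D') as <- by (apply mem_ext; intro q; now rewrite HD).
  exact (opair_unique Hw Hw').
- assert (Hrel : forall a D, related mem s a D <->
    a ∈ k /\ forall q, q ∈ D <-> In a q).
  { intros a D; split.
    - intros [w [Hw Hws]]; apply Hs in Hws.
      destruct Hws as [a' [Ha' [D' [HD' Hw']]]].
      destruct (opair_inj Hw Hw') as [-> ->]; now split.
    - intros [Ha HD]; destruct (opair_exists a D) as [w Hw].
      exists w; split; [exact Hw|]; apply Hs; exists a; split; [exact Ha|].
      now exists D. }
  assert (Hseq : decreasing_open_dense_sequence P k s).
  { split; [split; [|split]|split].
    - intros w Hw; apply Hs in Hw; destruct Hw as [a [Ha [D [_ Hw]]]]; now exists a, D.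
    - intros a Ha; destruct (is_set_bounded (B := fun q => q ∈ cond P) (Q := In a))
        as [D HD].
      + definability.
      + apply is_set_elements.
      + intros q Hq; apply Hq.
      + exists D; apply Hrel; split; [exact Ha|exact HD].
    - intros a D D' HD HD'; apply Hrel in HD, HD'; apply same_mem_eq, mem_ext.
      intro q; now rewrite (proj2 HD), (proj2 HD').
    - intros a D Ha HD; apply Hrel in HD; destruct HD as [_ HD].
      assert (Hc : forall p, elements D p -> p ∈ cond P).
      { intros p Hp; exact (proj1 (proj1 (HD p) Hp)). }
      split; (split; [exact Hc|]).
      + intros p q Hp Hq Hle; apply HD in Hp; apply HD; split; [exact Hq|].
        destruct Hp as [Hp [Hp'|Hp']]; [left|right].
        * intros [r [Hr [Hrq Hrp]]]; apply Hp'; exists r.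
          split; [exact Hr|split; [now apply le_trans with q|exact Hrp]].
        * intros b Hb; destruct (Hp' b Hb) as [v [z [Hz Hd]]].
          exists v, z; split; [exact Hz|]; now apply densely_below with p.
      + intros p Hp; destruct (classic (compatible P p p0)) as [[r [Hr [Hrp Hrp0]]]|L].
        * assert (L : exists q, q ∈ cond P /\ le P q r /\ decides t q a).
          { apply NNPP; intro M; apply (K r Hr Hrp0); exists a.
            split; [exact Ha|]; intros q Hq Hle N; apply M; now exists q. }
          destruct L as [q [Hq [Hle L]]]; exists q; split.
          { apply HD; split; [exact Hq|now right]. }
          now apply le_trans with r.
        * exists p; split; [|now apply le_refl].
          apply HD; split; [exact Hp|now left].
    - intros a b D D' Hb Hab HD HD' q Hq; apply Hrel in HD, HD'.
      apply HD' in Hq; apply HD; destruct Hq as [Hq [Hq'|Hq']]; split; auto.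
      right; intros c Hc; apply Hq'; left.
      destruct Hc as [Hc| ->]; [now apply (Hk' b Hb a Hab)|exact Hab]. }
  destruct (is_set_bounded (B := fun q => q ∈ cond P) (Q := fun q => q ∈ cond P /\
     forall a D, a ∈ k -> related mem s a D -> q ∈ D)) as [C HC].
  { definability. }
  { apply is_set_elements. }
  { tauto. }
  assert (HGC : exists q, G q /\ q ∈ C).
  { destruct (HP s Hseq) as [_ HdC].
    destruct HG as [_ [_ [_ [_ HG]]]]; apply HG; split.
    - intros q Hq; now apply HC in Hq.
    - intros q Hq; destruct (proj2 HdC q Hq) as [r [Hr Hle]]; exists r.
      split; [now apply HC|exact Hle]. }
  destruct HGC as [q [Hq HqC]]; apply HC in HqC.
  assert (Hdec : forall a, a ∈ k -> exists v z, is_opair mem z a v /\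
    densely P (fun q' => forces_mem P t q' z) q).
  { intros a Ha; destruct Hseq as [[_ [Htot _]] _].
    destruct (Htot a Ha) as [D HD].
    destruct (proj2 (proj1 (proj2 (proj1 (Hrel a D) HD) q) (proj2 HqC a D Ha HD)))
      as [L|L].
    - destruct L; now apply (generic_compatible HG).
    - apply L; now right. }
  assert (Htrue : forall z, densely P (fun q' => forces_mem P t q' z) q ->
    set_mem (emb z) f).
  { intros z Hz; apply (set_mem_eq_r (set_eq_sym Hft)), (truth_mem _ _ HG).
    apply (generic_densely HG (p := q)); [definability|exact Hq|exact Hz]. }
  destruct Hfresh as [Hf [Hv [HfV _]]]; apply HfV.
  (* What [q] forces is true, so [q] forces at most one value at each [a]; the
     values that it forces form a set of [V], which is [f]. *)
  destruct (is_set_image (Q := fun a z => exists v, is_opair mem z a v /\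
     densely P (fun q' => forces_mem P t q' z) q) (a := k)) as [m Hm].
  + unfold densely; definability.
  + intros a z z' _ [v [Hz Hd]] [v' [Hz' Hd']].
    apply (function_unique Hf Hz Hz'); auto.
  + exists m; apply set_eq_same; intro y; rewrite set_mem_emb; split.
    * intro Hy; destruct (function_element Hf Hv Hy) as [a [v [z [Ha [Hz Hyz]]]]].
      destruct (Hdec a Ha) as [v' [z' [Hz' Hd]]].
      exists z; split; [|exact Hyz]; apply Hm; exists a; split; [exact Ha|].
      assert (z = z') as <-.
      { apply (function_unique Hf Hz Hz'); [|now apply Htrue].
        now apply set_mem_eq_l with y. }
      now exists v.
    * intros [z [Hz Hyz]]; apply Hm in Hz; destruct Hz as [a [_ [v [_ Hd]]]].
      apply set_mem_eq_l with (emb z); [now apply set_eq_sym|now apply Htrue].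
Qed.

End NoFresh.

(** * Check names *)

Section CheckNames.
Variables (V : transitive_model) (P : forcing V).
Local Infix "∈" := (mem (V := V)) (at level 70).

Definition check_step (R : V -> V -> Prop) (a n : V) :=
  (forall b, b ∈ a -> exists m, R b m /\ related mem n m (top P)) /\
  (forall z, z ∈ n -> exists b m, b ∈ a /\ R b m /\ is_opair mem z m (top P)).

(** [n] is the check name of [a].  As with [forces_eq], a set of pairs that
    justify each other replaces recursion on [a]. *)
Definition check (a n : V) :=
  exists R, related mem R a n /\
    forall b m, related mem R b m -> check_step (related mem R) b m.

Lemma definable_check : definable2 mem check.
Proof. unfold check, check_step; definability. Qed.

Lemma check_unfold a n : check a n -> check_step check a n.
Proof.
intros [R [Hn K]]; destruct (K a n Hn) as [H1 H2]; split.
- intros b Hb; destruct (H1 b Hb) as [m [Hm L]]; exists m.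
  split; [now exists R|exact L].
- intros z Hz; destruct (H2 z Hz) as [b [m [Hb [Hm L]]]]; exists b, m.
  split; [exact Hb|split; [now exists R|exact L]].
Qed.

(** The justification stays inside a transitive set containing [a] and [n]. *)
Lemma check_fold a n : check_step check a n -> check a n.
Proof.
intro H.
destruct (transitive_superset2 a n) as [d [Hd [Ha Hn]]].
destruct (is_set_bounded
  (B := fun z => exists b m, b ∈ d /\ m ∈ d /\ is_opair mem z b m)
  (Q := fun z => exists b m, b ∈ d /\ (m ∈ d /\ check_step check b m) /\
     is_opair mem z b m)) as [R HR].
- pose proof definable_check; unfold check_step; definability.
- apply is_set_product; apply is_set_elements.
- intros z [b [m Hz]]; exists b, m; tauto.
- assert (K : forall b m, related mem R b m <->
    b ∈ d /\ m ∈ d /\ check_step check b m).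
  { intros b m; split.
    - intros [z [Hz HzR]]; apply HR in HzR.
      destruct HzR as [b' [m' [Hb [Hm Hz']]]].
      destruct (opair_inj Hz Hz') as [-> ->]; tauto.
    - intro L; destruct (opair_exists b m) as [z Hz].
      exists z; split; [exact Hz|]; apply HR; exists b, m; tauto. }
  exists R; split; [now apply K|].
  intros b m L; apply K in L; destruct L as [Hb [Hm [H1 H2]]]; split.
  + intros c Hc; destruct (H1 c Hc) as [l [Hl L]]; exists l; split; [|exact L].
    apply K; split; [now apply (Hd b Hb)|split; [|now apply check_unfold]].
    now apply (transitive_related Hd Hm L).
  + intros z Hz; destruct (H2 z Hz) as [c [l [Hc [Hl L]]]].
    exists c, l; split; [exact Hc|split; [|exact L]].
    apply K; split; [now apply (Hd b Hb)|split; [|now apply check_unfold]].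
    apply (transitive_related (r := m) (a := l) (b := top P) Hd Hm); now exists z.
Qed.

Lemma check_unique a n n' : check a n -> check a n' -> n = n'.
Proof.
revert n n'; induction a as [a IH] using (well_founded_ind (mem_wf V)).
assert (K : forall n n', check a n -> check a n' -> subset mem n n').
{ intros n n' Hn Hn' z Hz.
  apply check_unfold in Hn, Hn'; destruct Hn as [_ Hn], Hn' as [Hn' _].
  destruct (Hn z Hz) as [b [m [Hb [Hm L]]]].
  destruct (Hn' b Hb) as [m' [Hm' L']].
  rewrite (IH b Hb m m' Hm Hm') in L; now apply (opair_related n' L). }
intros n n' Hn Hn'; apply mem_ext; intro z; split; now apply K.
Qed.

Lemma check_exists a : exists n, check a n.
Proof.
induction a as [a IH] using (well_founded_ind (mem_wf V)).
destruct (is_set_image (Q := fun b z => exists m, check b m /\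
  is_opair mem z m (top P)) (a := a)) as [n Hn].
- pose proof definable_check; definability.
- intros b z z' _ [m [Hm Hz]] [m' [Hm' Hz']].
  rewrite (check_unique Hm Hm') in Hz; exact (opair_unique Hz Hz').
- exists n; apply check_fold; split.
  + intros b Hb; destruct (IH b Hb) as [m Hm].
    destruct (opair_exists m (top P)) as [z Hz].
    exists m; split; [exact Hm|exists z; split; [exact Hz|]].
    apply Hn; exists b; split; [exact Hb|now exists m].
  + intros z Hz; apply Hn in Hz; destruct Hz as [b [Hb [m L]]]; now exists b, m.
Qed.

Lemma val_check G a n : G (top P) -> check a n -> set_eq (val G n) (emb a).
Proof.
intro HG; revert n; induction a as [a IH] using (well_founded_ind (mem_wf V)).
intros n Hn; destruct (check_unfold Hn) as [H1 H2].
apply set_eq_same; intro x; rewrite set_mem_val, set_mem_emb; split.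
- intros [m [p [_ [[z [Hz Hzn]] Hx]]]].
  destruct (H2 z Hzn) as [b [m' [Hb [Hm Hz']]]].
  destruct (opair_inj Hz Hz') as [<- _].
  exists b; split; [exact Hb|]; exact (set_eq_trans Hx (IH b Hb m Hm)).
- intros [b [Hb Hx]]; destruct (H1 b Hb) as [m [Hm Hmn]].
  exists m, (top P); split; [exact HG|split; [exact Hmn|]].
  exact (set_eq_trans Hx (set_eq_sym (IH b Hb m Hm))).
Qed.

(** The name made of the pairs of a check name of [z] and a condition [p] with
    [W z p].  It turns a description of elements of [V] by what conditions force
    into a set of the extension. *)
Lemma name_of_relation (W : V -> V -> Prop) (Z : V -> Prop) :
  definable2 mem W -> is_set Z -> (forall z p, W z p -> Z z /\ p ∈ cond P) ->
  exists t, forall G, generic P G -> forall x,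
    set_mem x (val G t) <-> exists z p, W z p /\ G p /\ set_eq x (emb z).
Proof.
intros DW [a Ha] HW; pose proof definable_check as Dc.
assert (HN : is_set (fun n => exists z, z ∈ a /\ check z n)).
{ apply is_set_image; [exact Dc|intros z n n' _; apply check_unique]. }
destruct (is_set_bounded
  (B := fun w => exists n p, (exists z, z ∈ a /\ check z n) /\ p ∈ cond P /\
     is_opair mem w n p)
  (Q := fun w => exists z n p, W z p /\ check z n /\ is_opair mem w n p)) as [t Ht].
- definability.
- apply is_set_product; [exact HN|apply is_set_elements].
- intros w [z [n [p [Hw [Hn Hwnp]]]]]; destruct (HW z p Hw) as [Hz Hp].
  exists n, p; split; [|now split]; exists z; now rewrite Ha.
- exists t; intros G HG x; rewrite set_mem_val; split.
  + intros [n [p [Hp [[w [Hw Hwt]] Hx]]]]; apply Ht in Hwt.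
    destruct Hwt as [z [n' [p' [Hz [Hn Hw']]]]].
    destruct (opair_inj Hw Hw') as [<- <-]; exists z, p.
    split; [exact Hz|split; [exact Hp|]].
    exact (set_eq_trans Hx (val_check (generic_top HG) Hn)).
  + intros [z [p [Hz [Hp Hx]]]]; destruct (check_exists z) as [n Hn].
    destruct (opair_exists n p) as [w Hw].
    exists n, p; split; [exact Hp|split].
    * exists w; split; [exact Hw|]; apply Ht; now exists z, n, p.
    * exact (set_eq_trans Hx (set_eq_sym (val_check (generic_top HG) Hn))).
Qed.

End CheckNames.

(** * Fresh functions from failures of distributivity *)

Section Remainders.
Variables (V : transitive_model) (P : forcing V).
Local Infix "∈" := (mem (V := V)) (at level 70).

Definition remainder (G : V -> Prop) (D x : V) :=
  forall q, q ∈ x <-> G q /\ ~ q ∈ D.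

(** [p] forces that [G \ D] is [x].  By separativity, forcing [q] into [G]
    amounts to [p <= q], and forcing it out amounts to incompatibility. *)
Definition forces_remainder (p D x : V) :=
  (forall q, q ∈ x -> q ∈ cond P /\ ~ q ∈ D /\ le P p q) /\
  (forall q, q ∈ cond P -> ~ q ∈ D -> ~ q ∈ x -> ~ compatible P q p).

Lemma definable_forces_remainder : definable3 mem forces_remainder.
Proof.
pose proof (definable_le P); unfold forces_remainder, compatible; definability.
Qed.

(** If [x] is the remainder, some condition of [G] has no strengthening that puts
    a [q] on the wrong side of [x]; by separativity it then settles every [q]
    outside [D] correctly. *)
Lemma truth_remainder G D x :
  generic P G -> ((exists p, G p /\ forces_remainder p D x) <-> remainder G D x).
Proof.
intro HG; pose proof (definable_le P) as Dle; split.
- intros [p [Hp [H1 H2]]] q; split.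
  + intro Hq; destruct (H1 q Hq) as [Hqc [HqD Hpq]].
    split; [now apply (generic_up HG Hp)|exact HqD].
  + intros [Hq HqD]; apply NNPP; intro Hqx.
    apply (H2 q); auto; [exact (generic_cond HG Hq)|].
    now apply (generic_compatible HG).
- intro H.
  destruct (generic_decides (P := P) (G := G) (Q := fun p =>
    (exists q, q ∈ x /\ ~ compatible P q p) \/
    (exists q, q ∈ cond P /\ ~ q ∈ D /\ ~ q ∈ x /\ le P p q)))
    as [p [Hp [[[q [Hq K]]|[q [Hq [HqD [Hqx K]]]]]|K]]].
  + exact HG.
  + unfold compatible; definability.
  + destruct K; apply (generic_compatible HG); [now apply H|exact Hp].
  + destruct Hqx; apply H; split; [now apply (generic_up HG Hp)|exact HqD].
  + assert (Hpc := generic_cond HG Hp).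
    exists p; split; [exact Hp|split].
    * intros q Hq; destruct (proj1 (H q) Hq) as [HqG HqD].
      assert (Hqc := generic_cond HG HqG).
      split; [exact Hqc|split; [exact HqD|]]; apply NNPP; intro L.
      destruct (separative Hqc Hpc L) as [p' [Hp' [Hle M]]].
      apply (K p' Hp' Hle); left; exists q; split; [exact Hq|].
      intros [r [Hr [Hrq Hrp]]]; apply M; now exists r.
    * intros q Hq HqD Hqx [r [Hr [Hrq Hrp]]].
      apply (K r Hr Hrp); right; now exists q.
Qed.

(** Otherwise the conditions outside [G] would be dense, and form a set of [V]. *)
Lemma generic_in_V_atomic G g :
  generic P G -> (forall q, q ∈ g <-> G q) ->
  exists p, G p /\ forall q, q ∈ cond P -> le P q p -> G q.
Proof.
intros HG Hg.
destruct (generic_decides (P := P) (G := G) (Q := fun q => ~ q ∈ g))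
  as [p [Hp [K|K]]]; [exact HG|definability| |].
- now destruct K; apply Hg.
- exists p; split; [exact Hp|]; intros q Hq Hle; apply Hg, NNPP, K; auto.
Qed.

(** All strengthenings of [p] are compatible with one another, so by separativity
    [p] is below each of them; one of them is in [D], which is open. *)
Lemma atom_in_open_dense G p D :
  generic P G -> G p -> (forall q, q ∈ cond P -> le P q p -> G q) ->
  open_dense P (elements D) -> p ∈ D.
Proof.
intros HG Hp Hat [[_ Hop] [HDc HD]].
assert (Hpc := generic_cond HG Hp).
destruct (HD p Hpc) as [q [Hq Hqp]].
apply (Hop q); [exact Hq|exact Hpc|].
assert (Hqc := HDc q Hq); apply NNPP; intro L.
destruct (separative Hqc Hpc L) as [r [Hr [Hrp M]]]; apply M.
apply (generic_compatible HG); auto.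
Qed.

Theorem no_fresh_descending_distributive k :
  ordinal mem k -> has_generic_filters P ->
  (forall G D, generic P G -> open_dense P (elements D) ->
     exists x, remainder G D x) ->
  adds_no_fresh_functions P k -> descending_distributive P k.
Proof.
intros [Hk _] Hgen Hrem Hno s [[Hs1 [Hs2 Hs3]] [Hod Hdec]].
assert (Hop : open P (fun p => p ∈ cond P /\
    forall a D, a ∈ k -> related mem s a D -> p ∈ D)).
{ split; [now intros p [Hp _]|].
  intros p q [Hp HpD] Hq Hle; split; [exact Hq|]; intros a D Ha HD.
  destruct (Hod a D Ha HD) as [[_ H] _]; apply (H p q); auto; now apply (HpD a). }
split; [exact Hop|split; [now intros p [Hp _]|]].
intros p0 Hp0; apply NNPP; intro Hnone.
destruct (Hgen p0 Hp0) as [G [HG HGp0]].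
assert (Hmiss : forall q, G q ->
    ~ forall a D, a ∈ k -> related mem s a D -> q ∈ D).
{ intros q Hq L.
  destruct (generic_directed HG Hq HGp0) as [r [Hr [Hrq Hrp]]].
  apply Hnone; exists r; split; [|exact Hrp].
  apply (proj2 Hop q); [|exact (generic_cond HG Hr)|exact Hrq].
  split; [exact (generic_cond HG Hq)|exact L]. }
(* The name of the function sending [a] to its remainder. *)
pose (W := fun z p => p ∈ cond P /\ exists a x D, a ∈ k /\ related mem s a D /\
  is_opair mem z a x /\ forces_remainder p D x).
destruct (name_of_relation (P := P) (W := W)
  (Z := fun z => exists a x, a ∈ k /\ subset mem x (cond P) /\ is_opair mem z a x))
  as [t Ht].
- pose proof definable_forces_remainder; unfold W; definability.
- apply is_set_product; [apply is_set_elements|apply is_set_subsets].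
- intros z p [Hp [a [x [D [Ha [HD [Hz [K _]]]]]]]]; split; [|exact Hp].
  exists a, x; split; [exact Ha|split; [|exact Hz]]; intros q Hq; now apply K.
- assert (Hf : forall y, set_mem y (val G t) <-> exists a x D z, a ∈ k /\
    related mem s a D /\ remainder G D x /\ is_opair mem z a x /\ set_eq y (emb z)).
  { intro y; rewrite (Ht G HG y); split.
    - intros [z [p [[_ [a [x [D [Ha [HD [Hz K]]]]]]] [Hp Hy]]]].
      assert (Hx : remainder G D x) by (apply truth_remainder; [exact HG|now exists p]).
      now exists a, x, D, z.
    - intros [a [x [D [z [Ha [HD [Hx [Hz Hy]]]]]]]].
      apply (truth_remainder D x HG) in Hx; destruct Hx as [p [Hp Hx]].
      exists z, p; split; [split; [exact (generic_cond HG Hp)|]|now split].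
      now exists a, x, D. }
  assert (Huniq : forall a D D' x x', related mem s a D -> related mem s a D' ->
    remainder G D x -> remainder G D' x' -> x = x').
  { intros a D D' x x' HD HD' Hx Hx'.
    assert (D = D') as <- by (apply same_mem_eq, (Hs3 a D D' HD HD')).
    apply mem_ext; intro q; now rewrite (Hx q), (Hx' q). }
  assert (Hmem : forall a, a ∈ k -> exists D x z, related mem s a D /\
    remainder G D x /\ is_opair mem z a x /\ set_mem (emb z) (val G t)).
  { intros a Ha; destruct (Hs2 a Ha) as [D HD].
    destruct (Hrem G D HG (Hod a D Ha HD)) as [x Hx].
    destruct (opair_exists a x) as [z Hz]; exists D, x, z.
    split; [exact HD|split; [exact Hx|split; [exact Hz|]]].
    apply Hf; exists a, x, D, z.
    exact (conj Ha (conj HD (conj Hx (conj Hz (set_eq_refl _))))). }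
  apply (Hno G HG); exists (val G t); split; [exists t; apply set_eq_refl|].
  assert (Hrel : forall b y, related set_mem (val G t) b y ->
    exists a x D, set_eq b (emb a) /\ set_eq y (emb x) /\
      related mem s a D /\ remainder G D x).
  { intros b y [w [Hw Hwf]]; apply Hf in Hwf.
    destruct Hwf as [a [x [D [z [Ha [HD [Hx [Hz Hwz]]]]]]]].
    exists a, x, D; destruct (opair_emb_inv Hz Hw Hwz); auto. }
  split; [split; [|split]|split; [|split]].
  + intros y Hy; apply Hf in Hy.
    destruct Hy as [a [x [D [z [Ha [HD [Hx [Hz Hy]]]]]]]].
    exists (emb a), (emb x); split; [now apply emb_mem|exact (opair_of_emb Hz Hy)].
  + intros b Hb; apply set_mem_emb in Hb; destruct Hb as [a [Ha Hb]].
    destruct (Hmem a Ha) as [D [x [z [HD [Hx [Hz Hzf]]]]]].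
    exists (emb x), (emb z); split; [|exact Hzf].
    apply (is_opair_cong (emb_opair Hz)); [|apply same_refl].
    now apply set_eq_same, set_eq_sym.
  + intros b y y' Hy Hy'.
    destruct (Hrel b y Hy) as [a [x [D [Hb [Hyx [HD Hx]]]]]].
    destruct (Hrel b y' Hy') as [a' [x' [D' [Hb' [Hyx' [HD' Hx']]]]]].
    assert (a = a') as <- by exact (emb_inj (set_eq_trans (set_eq_sym Hb) Hb')).
    rewrite (Huniq a D D' x x' HD HD' Hx Hx') in Hyx.
    apply set_eq_same; exact (set_eq_trans Hyx (set_eq_sym Hyx')).
  + intros b y Hy; destruct (Hrel b y Hy) as [a [x [D [_ [Hyx _]]]]]; now exists x.
  (* If the function were in [V], then so would be [G], the union of its values. *)
  + intros [m Hm].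
    destruct (is_set_bounded (B := fun q => q ∈ cond P) (Q := fun q => q ∈ cond P /\
      exists a x, related mem m a x /\ q ∈ x)) as [g Hg].
    * definability.
    * apply is_set_elements.
    * tauto.
    * destruct (generic_in_V_atomic (G := G) (g := g) HG) as [p [Hp Hat]].
      { intro q; rewrite (Hg q); split.
        - intros [_ [a [x [[z [Hz Hzm]] Hq]]]].
          assert (Hzf : set_mem (emb z) (val G t)).
          { apply (set_mem_eq_r (set_eq_sym Hm)), emb_mem, Hzm. }
          apply Hf in Hzf; destruct Hzf as [a' [x' [D [z' [_ [_ [Hx [Hz' L]]]]]]]].
          apply emb_inj in L; subst z'; destruct (opair_inj Hz Hz') as [_ <-].
          now apply Hx in Hq.
        - intro Hq; split; [exact (generic_cond HG Hq)|].
          apply NNPP; intro L; apply (Hmiss q Hq); intros a D Ha HD.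
          apply NNPP; intro HqD; apply L.
          destruct (Hmem a Ha) as [D' [x [z [HD' [Hx [Hz Hzf]]]]]].
          assert (D = D') as <- by (apply same_mem_eq, (Hs3 a D D' HD HD')).
          exists a, x; split; [|now apply Hx].
          exists z; split; [exact Hz|]; apply emb_mem, (set_mem_eq_r Hm), Hzf. }
      apply (Hmiss p Hp); intros a D Ha HD.
      now apply (atom_in_open_dense HG Hp Hat), (Hod a).
  (* The value at [a] determines the earlier ones. *)
  + intros a Ha; destruct (Hmem a Ha) as [Da [xa [_ [HDa [Hxa _]]]]].
    assert (Hcut : forall b D x, b ∈ a -> related mem s b D ->
      (remainder G D x <-> forall q, q ∈ x <-> q ∈ xa /\ ~ q ∈ D)).
    { intros b D x Hb HD; assert (L := Hdec b a D Da Ha Hb HD HDa).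
      split; intros H q; rewrite (H q), (Hxa q); specialize (L q); tauto. }
    destruct (is_set_image (Q := fun b z => exists D x, related mem s b D /\
       (forall q, q ∈ x <-> q ∈ xa /\ ~ q ∈ D) /\ is_opair mem z b x) (a := a))
      as [g Hg].
    * definability.
    * intros b z z' Hb [D [x [HD [Hx Hz]]]] [D' [x' [HD' [Hx' Hz']]]].
      apply (Hcut b D x Hb HD) in Hx; apply (Hcut b D' x' Hb HD') in Hx'.
      rewrite (Huniq b D D' x x' HD HD' Hx Hx') in Hz; exact (opair_unique Hz Hz').
    * exists (emb g); split; [|exists g; apply set_eq_refl].
      intro y; rewrite set_mem_emb, (Hf y); split.
      { intros [z [Hz Hy]]; apply Hg in Hz.
        destruct Hz as [b [Hb [D [x [HD [Hx Hz]]]]]].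
        apply (Hcut b D x Hb HD) in Hx; split.
        - exists b, x, D, z; split; [now apply (Hk a)|auto].
        - exists (emb b), (emb x); split; [now apply emb_mem|exact (opair_of_emb Hz Hy)]. }
      { intros [[b [x [D [z [_ [HD [Hx [Hz Hy]]]]]]]] [b' [y' [Hb' Hbw]]]].
        exists z; split; [|exact Hy]; apply Hg; exists b.
        destruct (opair_emb_inv Hz Hbw Hy) as [Hbb _].
        assert (Hb : b ∈ a) by (apply emb_mem; now apply set_mem_eq_l with b').
        split; [exact Hb|]; exists D, x; split; [exact HD|split; [|exact Hz]].
        now apply (Hcut b D x Hb HD). }
Qed.

End Remainders.

Theorem theorem1p13 (V : transitive_model) (k : V) (P : forcing V)
  (Hk : cardinal mem k) :
  (descending_distributive P k -> adds_no_fresh_functions P k) /\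
  (has_generic_filters P ->
   (forall (G : V -> Prop) (D : V),
      generic P G -> open_dense P (elements D) ->
      exists x : V, forall p, mem p x <-> G p /\ ~ mem p D) ->
   (descending_distributive P k <-> adds_no_fresh_functions P k)).
Proof.
destruct Hk as [Hord _].
assert (Ha : descending_distributive P k -> adds_no_fresh_functions P k).
{ exact (descending_distributive_no_fresh Hord). }
split; [exact Ha|].
intros Hgen Hrem; split; [exact Ha|].
exact (no_fresh_descending_distributive Hord Hgen Hrem).
Qed.
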